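(* Let $I$ be a monomial ideal in a polynomial ring $R$ in finitely many variables over a field $k$. Let $B = \{b_{i,j} \mid 1 \leq i \leq q,\ 0 \leq j \leq t_i\}$ be distinct variables of $R$ such that: (1) $d_{b_{i,j}}(I) \leq 1$ for all $1\le i\le q$ and $1\le j\le t_i$; and (2) for each $i=1,\dots,q$, if $M$ is a minimal monomial generator of $I$ and $b_{i,0}$ divides $M$, then there exists $j\ge 1$ such that $b_{i,j}$ divides $M$. Let $f_i = \sum_{j=0}^{t_i} b_{i,j}$ for $i = 1, \ldots, q$. Let $Y = \{y_1, \ldots, y_r\}$ be a collection of variables of $R$ that is disjoint from $B$, and let $h_1, \ldots, h_{\ell} \in k[y_1, \ldots, y_r] \subseteq R$ be such that the ideal $(I,h_1,\dots,h_\ell)$ is proper. Then $f_1, \ldots, f_q$ is an initially regular sequence on $R/(I, h_1, \ldots, h_{\ell})$, with respect to any term orders $>_1,\dots,>_q$ for which $b_{i,0}>_{i+1}b_{i,j}$ for all $1\le i\le q-1$ and all $1\le j\le t_i$.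
   Context: $\mathfrak m$ is the ideal of $R$ generated by all the variables. A term order is a monomial order (a total order on monomials, compatible with multiplication, with $1$ smallest), and $\mathrm{in}_>(J)$ is the initial ideal of $J$ with respect to $>$. For a monomial ideal $J$ and a variable $x$, $d_x(J)$ is the maximum exponent of $x$ in the minimal monomial generators of $J$ (and $0$ if $J=0$). An element $f\in\mathfrak m$ is regular on $R/J$ if it is a non-zerodivisor on $R/J$. For a proper ideal $K$ and term orders $>_1,\dots,>_q$, a sequence of nonconstant polynomials $f_1,\dots,f_q\in\mathfrak m$ is an initially regular sequence on $R/K$ (with respect to $>_1,\dots,>_q$) if for each $i=1,\dots,q$, $f_i$ is a regular element on $R/K_i$, where $K_1=\mathrm{in}_{>_1}(K)$ and $K_i=\mathrm{in}_{>_i}\big((K_{i-1},f_{i-1})\big)$ for $i\ge 2$. *)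

(* Defs.v *)
From HB Require Import structures.
From mathcomp Require Export all_boot all_order all_algebra.
From mathcomp Require Export freeg mpoly.

Set Implicit Arguments.
Unset Strict Implicit.
Unset Printing Implicit Defensive.

Import GRing.Theory.
Local Open Scope ring_scope.

(* Ideals of k[x_0, ..., x_(n-1)] are Prop-valued predicates on {mpoly k[n]}:
   membership in an arbitrary ideal is not a boolean test. *)
Section InitiallyRegular.
Variables (k : fieldType) (n : nat).
Implicit Types (J K G : {mpoly k[n]} -> Prop) (p f : {mpoly k[n]}).
Implicit Types (m : 'X_{1..n}) (le : rel 'X_{1..n}).

Definition ideal_gen G : {mpoly k[n]} -> Prop := fun p =>
  exists s : seq ({mpoly k[n]} * {mpoly k[n]}),
    (forall c, c \in s -> G c.2) /\ p = \sum_(c <- s) c.1 * c.2.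

Definition proper_ideal_pred J : Prop := ~ J 1.

Definition irrelevant_ideal : {mpoly k[n]} -> Prop :=
  ideal_gen (fun p => exists x : 'I_n, p = 'X_x).

Definition is_monomial_ideal J : Prop :=
  exists S : 'X_{1..n} -> Prop,
    forall p, J p <-> ideal_gen (fun g => exists2 m, S m & g = 'X_[m]) p.

(* [(_ <= _)%MM] is divisibility of monomials. *)
Definition minimal_generator J m : Prop :=
  J 'X_[m] /\ forall m', J 'X_[m'] -> (m' <= m)%MM -> m' = m.

(* [max_exponent x J d] is the graph of [d_x(J) = d]: the number d_x(J) is a
   maximum over a set that is finite by Dickson's lemma only. *)
Definition max_exponent (x : 'I_n) J (d : nat) : Prop :=
  (forall m, minimal_generator J m -> (m x <= d)%N) /\
  ((exists2 m, minimal_generator J m & m x = d) \/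
   ((forall p, J p -> p = 0) /\ d = 0%N)).

Definition is_term_order le : Prop :=
  [/\ reflexive le, antisymmetric le, transitive le & total le] /\
  (forall m, le 0%MM m) /\
  (forall m1 m2 m, le m1 m2 -> le (m + m1)%MM (m + m2)%MM).

Definition term_lt le m1 m2 : bool := (m1 != m2) && le m1 m2.

Definition leading_monomial le p m : Prop :=
  m \in msupp p /\ forall m', m' \in msupp p -> le m' m.

(* Zero has no leading monomial, so it contributes no generator. *)
Definition initial_ideal le J : {mpoly k[n]} -> Prop :=
  ideal_gen (fun g => exists p m, [/\ J p, leading_monomial le p m & g = 'X_[m]]).

Definition regular_mod J f : Prop := forall g, J (f * g) -> J g.

Definition in_subring (Y : {set 'I_n}) p : Prop :=
  forall m, m \in msupp p -> forall x, (0 < m x)%N -> x \in Y.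

Section Chain.
Variables (q : nat) (ord : 'I_q -> rel 'X_{1..n}).
Variables (K : {mpoly k[n]} -> Prop) (f : 'I_q -> {mpoly k[n]}).

(* Indices are shifted by one: [initial_chain 0] is K_1 = in_{>_1}(K) and
   [initial_chain i.+1] is K_(i+2) = in_{>_(i+2)}((K_(i+1), f_(i+1))). *)
Fixpoint initial_chain (i : nat) : (i < q)%N -> {mpoly k[n]} -> Prop :=
  match i with
  | 0 => fun lt0q => initial_ideal (ord (Ordinal lt0q)) K
  | j.+1 => fun ltjq =>
      initial_ideal (ord (Ordinal ltjq))
        (ideal_gen (fun p => initial_chain (ltnW ltjq) p \/
                             p = f (Ordinal (ltnW ltjq))))
  end.

Definition initially_regular : Prop :=
  forall i : 'I_q,
    [/\ (forall c : k, f i != c%:MP),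
        irrelevant_ideal (f i)
      & regular_mod (initial_chain (ltn_ord i)) (f i)].

End Chain.
End InitiallyRegular.

(* Main.v *)
(** Call a monomial ideal K compatible with the variables c_0, ..., c_t if
    c_j^2 u in K implies c_j u in K for j >= 1, and c_0 u in K implies u in K
    whenever no c_j with j >= 1 divides u.  This restates (1) and (2) without
    minimal generators, and makes c_0 + ... + c_t regular modulo K: if u is a
    monomial of g outside K with maximal c_j-degree among those, then c_j u is
    in K, as otherwise it would survive in (c_0 + ... + c_t) g.

    Compatibility passes from K to in(K + (G)) whenever the elements of G only
    involve a set V of variables disjoint from the c_j: the ideal K + (G) is
    graded by the monomials w in the variables outside V, its component in
    degree w depends only on (K : w), and (K : w) does not change under the
    moves defining compatibility.  This applies to G = {h_1, ..., h_l} first,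
    and then to each G = {f_i}. *)
Require Import Defs.
From HB Require Import structures.
From Stdlib Require Import Classical.

Set Implicit Arguments.
Unset Strict Implicit.
Unset Printing Implicit Defensive.

Import GRing.Theory.
Local Open Scope ring_scope.

(** * Ideals given by generators, monomial ideals and initial ideals *)

Section IdealGen.
Variables (k : fieldType) (n : nat).
Implicit Types (J K G : {mpoly k[n]} -> Prop) (p f g : {mpoly k[n]}).
Implicit Types (m u v : 'X_{1..n}) (S : 'X_{1..n} -> Prop).

Lemma ideal_gen_ind G (P : {mpoly k[n]} -> Prop) :
    P 0 -> (forall p g, P p -> P g -> P (p + g)) ->
    (forall a g, G g -> P (a * g)) ->
  forall p, ideal_gen G p -> P p.
Proof.
move=> P0 PD PM p [s [sG ->]]; elim: s sG => [|c s IHs] sG; first by rewrite big_nil.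
rewrite big_cons; apply: PD; first by apply: PM; apply: sG; rewrite mem_head.
by apply: IHs => c' c's; apply: sG; rewrite in_cons c's orbT.
Qed.

Lemma ideal_gen0 G : ideal_gen G 0.
Proof. by exists [::]; rewrite big_nil. Qed.

Lemma ideal_genD G p g : ideal_gen G p -> ideal_gen G g -> ideal_gen G (p + g).
Proof.
move=> [s [sG ->]] [s' [s'G ->]]; exists (s ++ s'); rewrite big_cat; split=> // c.
by rewrite mem_cat => /orP[/sG|/s'G].
Qed.

Lemma ideal_gen_mul G a g : G g -> ideal_gen G (a * g).
Proof. by move=> Gg; exists [:: (a, g)]; rewrite big_seq1; split=> // c /[!inE]/eqP->. Qed.

Lemma ideal_gen_incl G g : G g -> ideal_gen G g.
Proof. by move/(ideal_gen_mul 1); rewrite mul1r. Qed.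

Lemma ideal_genM G a p : ideal_gen G p -> ideal_gen G (a * p).
Proof.
apply: (ideal_gen_ind (P := fun p => ideal_gen G (a * p))).
- by rewrite mulr0; apply: ideal_gen0.
- by move=> p1 p2 h1 h2; rewrite mulrDr; apply: ideal_genD.
- by move=> a' g Gg; rewrite mulrA; apply: ideal_gen_mul.
Qed.

Lemma ideal_gen_monomials S p :
  ideal_gen (fun g => exists2 m, S m & g = 'X_[m]) p <->
  (forall m, m \in msupp p -> exists2 s, S s & (s <= m)%MM).
Proof.
split; last first.
  move=> pS; rewrite [p]mpolyE big_seq_cond.
  elim/big_rec: _ => [|m g /andP[/pS[s Ss sm] _] Jg]; first exact: ideal_gen0.
  apply: ideal_genD Jg; rewrite -mul_mpolyC -(submK sm) mpolyXD mulrA.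
  by apply: ideal_gen_mul; exists s.
move: p; apply: ideal_gen_ind => [m|p g pS gS m|a g [s Ss ->] m].
- by rewrite -mpolyC0 msupp0.
- by move/msuppD_le; rewrite mem_cat => /orP[/pS|/gS].
- rewrite (perm_mem (msuppMX _ _)) => /mapP[m' _ ->]; exists s => //.
  exact: lem_addr.
Qed.

Lemma monomial_idealP K p : is_monomial_ideal K ->
  K p <-> (forall m, m \in msupp p -> K 'X_[m]).
Proof.
case=> S KS; rewrite KS ideal_gen_monomials; split=> pS m /pS.
  by case=> s Ss sm; rewrite KS; apply/ideal_gen_monomials => m' /mem_msuppXP <-; exists s.
by rewrite KS ideal_gen_monomials; apply; rewrite msuppX mem_head.
Qed.

Lemma monomial_idealMl K u v : is_monomial_ideal K -> K 'X_[u] -> K 'X_[(u + v)%MM].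
Proof.
by case=> S KS /KS Ku; apply/KS; rewrite addmC mpolyXD; apply: ideal_genM.
Qed.

Lemma initial_ideal_monomial le J : is_monomial_ideal (initial_ideal le J).
Proof.
exists (fun m => exists2 p, J p & leading_monomial le p m) => p.
split; apply: ideal_gen_ind => //; try by [apply: ideal_gen0 | apply: ideal_genD].
  by move=> a g [p' [m [Jp lm ->]]]; apply: ideal_gen_mul; exists m => //; exists p'.
by move=> a g [m [p' Jp lm] ->]; apply: ideal_gen_mul; exists p', m.
Qed.

(** Leading monomials of an ideal are closed under multiples, so each monomial of the initial ideal
    is itself a leading monomial and not only a multiple of one. *)
Lemma initial_idealXP le G m : is_term_order le ->
  initial_ideal le (ideal_gen G) 'X_[m] <->
  exists2 p, ideal_gen G p & leading_monomial le p m.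
Proof.
move=> [_ [_ leD]]; split; last first.
  by case=> p Jp lm; apply: ideal_gen_incl; exists p, m.
move=> inX.
have : ideal_gen (fun g => exists2 m, (exists2 p, ideal_gen G p & leading_monomial le p m)
          & g = 'X_[m]) 'X_[m].
  move: inX; apply: ideal_gen_ind; try by [apply: ideal_gen0 | apply: ideal_genD].
  by move=> a g [p' [m' [Jp lm ->]]]; apply: ideal_gen_mul; exists m' => //; exists p'.
move/ideal_gen_monomials/(_ m); rewrite msuppX mem_head => /(_ isT)[u [p Jp [up lm]] um].
(* Multiplying by a monomial shifts the support and preserves the order, so the leading monomial [u]
   of [p] moves to [m]. *)
exists (p * 'X_[(m - u)%MM]); first by rewrite mulrC; apply: ideal_genM.
split; first by rewrite (perm_mem (msuppMX _ _)); apply/mapP; exists u; rewrite ?submK.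
move=> m'; rewrite (perm_mem (msuppMX _ _)) => /mapP[v /lm vu ->].
by rewrite -[X in le _ X](submK um); apply: leD.
Qed.

Lemma exists_minimal_generator J m : J 'X_[m] ->
  exists2 m', minimal_generator J m' & (m' <= m)%MM.
Proof.
have [d] := ubnP (mdeg m); elim: d m => // d IHd m md Jm.
case: (classic (minimal_generator J m)) => [|notmin]; first by exists m; rewrite ?lepm_refl.
have [m' [Jm' m'm neq]] : exists m', [/\ J 'X_[m'], (m' <= m)%MM & m' <> m].
  apply: NNPP => no; apply: notmin; split=> // m' Jm' m'm.
  by apply: NNPP => neq; apply: no; exists m'.
have md' : (mdeg m' < d)%N.
  apply: leq_trans (_ : mdeg m <= d)%N; last exact: md.
  rewrite -(submK m'm) mdegD -[X in (X < _)%N]add0n ltn_add2r lt0n mdeg_eq0.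
  by apply: contra_notN neq => /eqP m0; rewrite -(submK m'm) m0 add0m.
have [m1 min1 m1m'] := IHd _ md' Jm'.
by exists m1 => //; apply: lepm_trans m1m' m'm.
Qed.

End IdealGen.

(** * Extracting a graded component and dividing it by a variable *)

Section Slice.
Variables (k : fieldType) (n : nat) (a : pred 'X_{1..n}) (x : 'I_n).
Implicit Types (p g : {mpoly k[n]}) (m u v : 'X_{1..n}).

(* When [a] tests agreement with a fixed monomial [m] outside V, this is the
   component of [p] in the degree of [x * m], divided by [x]. *)
Definition slice p : {mpoly k[n]} :=
  \sum_(m <- msupp p | (U_(x) <= m)%MM && a (m - U_(x))%MM)
    p@_m *: 'X_[(m - U_(x))%MM].

Lemma mcoeff_slice p m : (slice p)@_m = p@_(m + U_(x)) *+ a m.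
Proof.
rewrite /slice raddf_sum /=.
under eq_bigr do rewrite mcoeffZ mcoeffX.
have lex : (U_(x) <= m + U_(x))%MM by apply: lem_addl.
have [am|nam] := boolP (a m); last first.
  rewrite big1 // => u /andP[xu au]; case: eqP => [eq_um|]; last by rewrite mulr0.
  by rewrite -eq_um au in nam.
have [ms|mNs] := boolP ((m + U_(x))%MM \in msupp p).
  rewrite big_mkcond (bigD1_seq (m + U_(x))%MM) ?msupp_uniq //= lex addmK am eqxx mulr1.
  rewrite big1 ?addr0 // => u neq; case: ifP => // /andP[xu _].
  by case: eqP => [eq_um|]; rewrite ?mulr0 //; rewrite -eq_um submK ?eqxx in neq.
rewrite (memN_msupp_eq0 mNs) big_seq_cond big1 // => u /and3P[us xu _].
by case: eqP => [eq_um|]; rewrite ?mulr0 //; rewrite -eq_um submK ?us in mNs.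
Qed.

Lemma slice_is_linear : linear slice.
Proof.
move=> c p g; apply/mpolyP => m; rewrite mcoeffD mcoeffZ !mcoeff_slice mcoeffD mcoeffZ.
by rewrite mulrnAr mulrnDl.
Qed.

HB.instance Definition _ :=
  GRing.isLinear.Build k {mpoly k[n]} {mpoly k[n]} _ slice slice_is_linear.

Lemma mem_msupp_slice p m : (m \in msupp (slice p)) = a m && ((m + U_(x))%MM \in msupp p).
Proof. by rewrite !mcoeff_msupp mcoeff_slice; case: (a m); rewrite ?mulr0n ?eqxx. Qed.

Lemma sliceX m : slice 'X_[m] =
  if (U_(x) <= m)%MM && a (m - U_(x))%MM then 'X_[(m - U_(x))%MM] else 0.
Proof.
rewrite /slice msuppX big_seq_cond /= big_mkcond big_seq1 inE eqxx /=.
by rewrite mcoeffX eqxx scale1r.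
Qed.

(** Multiplying by [g] leaves exponents outside [V] unchanged, and both divisibility by [x] and the
    test [a] look only at those. *)
Lemma slice_mul (V : {set 'I_n}) p g : x \notin V ->
    (forall u v, (forall y, y \notin V -> u y = v y) -> a u = a v) ->
  in_subring V g -> slice (p * g) = slice p * g.
Proof.
move=> xV aV gV; rewrite [g]mpolyE [p]mpolyE mulr_suml !linear_sum /= mulr_suml.
apply: eq_bigr => u _; rewrite mulr_sumr linear_sum /= mulr_sumr big_seq [RHS]big_seq.
apply: eq_bigr => v vg.
have vV y : y \notin V -> v y = 0%N.
  by move=> yV; apply/eqP; rewrite -leqn0 leqNgt; apply/negP => /(gV _ vg); apply/negP.
rewrite -scalerAl -!scalerAr scalerA -mpolyXD !linearZ /= !sliceX -scalerAl scalerA.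
congr (_ *: _); first exact: mulrC.
have xuv : (U_(x) <= u + v)%MM = (U_(x) <= u)%MM.
  apply/mnm_lepP/mnm_lepP => h y; have := h y; rewrite mnmDE mnm1E; last first.
    by move=> hy; apply: leq_trans hy (leq_addr _ _).
  by case: eqP => // <-; rewrite (vV x xV) addn0.
rewrite xuv; case: (boolP (U_(x) <= u)%MM) => /= [xu|_]; last by rewrite mul0r.
have -> : (u + v - U_(x) = u - U_(x) + v)%MM by rewrite addmC -addmBA // addmC.
rewrite (aV _ (u - U_(x))%MM) => [|y /vV vy]; last by rewrite mnmDE vy addn0.
by case: (a _); rewrite ?mul0r // mpolyXD.
Qed.

End Slice.

(** * Saturation conditions, their passage to initial ideals, and regularity *)

Section Saturation.
Variables (k : fieldType) (n : nat).
Implicit Types (J K G : {mpoly k[n]} -> Prop) (D : 'X_{1..n} -> Prop).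
Implicit Types (le : rel 'X_{1..n}).

Definition saturated x D K := forall m, D m -> K 'X_[(m + U_(x))%MM] -> K 'X_[m].

(** If [p] in K + (G) has leading monomial [x * m], its slice in that degree outside [V] has leading
    monomial [m]. The slice stays in K + (G): it commutes with multiplication by elements of [G],
    and saturation allows the division by [x] inside [K]. *)
Lemma saturated_initial_ideal (V : {set 'I_n}) x D K G le :
    is_term_order le -> is_monomial_ideal K ->
    (forall g, G g -> in_subring V g) -> x \notin V ->
    (forall u v : 'X_{1..n}, (forall y, y \notin V -> u y = v y) -> D u -> D v) ->
    saturated x D K ->
  saturated x D (initial_ideal le (ideal_gen (fun p => K p \/ G p))).
Proof.
move=> le_ord Kmon GV xV DV Ksat m Dm /(initial_idealXP _ _ le_ord)[p Jp [mp pm]].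
pose a : pred 'X_{1..n} := fun u => [forall y, (y \notin V) ==> (u y == m y)].
have aP (u : 'X_{1..n}) : reflect (forall y, y \notin V -> u y = m y) (a u).
  apply: (iffP forallP) => [au y yV|au y]; first by have /implyP/(_ yV)/eqP := au y.
  by apply/implyP => /au ->.
have aV (u v : 'X_{1..n}) : (forall y, y \notin V -> u y = v y) -> a u = a v.
  by move=> uv; apply/aP/aP => h y yV; rewrite -h ?uv.
apply/(initial_idealXP _ _ le_ord); exists (slice a x p); last first.
  split; first by rewrite mem_msupp_slice mp andbT; apply/aP.
  move=> u; rewrite mem_msupp_slice => /andP[_ /pm].
  move: le_ord => [[refl anti _ tot] [_ leD]].
  (* The order can be cancelled: [x * u] is at most [x * m], so if [m] is at most [u], antisymmetry
     forces equality. *)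
  have [//|mu um] := orP (tot u m).
  have /addmI <- : (U_(x) + m = U_(x) + u)%MM; last exact: refl.
  by apply: anti; rewrite leD // addmC [(U_(x) + m)%MM]addmC um.
move: p Jp {mp pm}; apply: ideal_gen_ind => [|p g|c g].
- by rewrite linear0; apply: ideal_gen0.
- by rewrite linearD; apply: ideal_genD.
case=> [Kg|Gg]; last first.
  by rewrite (slice_mul _ xV aV (GV _ Gg)); apply: ideal_gen_mul; right.
apply: ideal_gen_incl; left; apply/(monomial_idealP _ Kmon) => u.
rewrite mem_msupp_slice => /andP[/aP au us]; apply: Ksat.
  by apply: DV Dm => y /au.
have Kcg : K (c * g) by case: Kmon => S KS; apply/KS/ideal_genM/KS.
exact: (monomial_idealP _ Kmon).1 Kcg _ us.
Qed.

(** The condition on [c j] is stated for a monomial already divisible by [c j], which encodes the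
    passage from the square to the first power. *)
Definition compatible t (c : 'I_t.+1 -> 'I_n) K :=
  (forall j : 'I_t.+1, (1 <= j)%N -> saturated (c j) (fun m => 0 < m (c j))%N K) /\
  saturated (c ord0) (fun m => forall j : 'I_t.+1, (1 <= j)%N -> m (c j) = 0%N) K.

Lemma compatible_initial_ideal (V : {set 'I_n}) t (c : 'I_t.+1 -> 'I_n) K G le :
    is_term_order le -> is_monomial_ideal K ->
    (forall g, G g -> in_subring V g) -> (forall j, c j \notin V) ->
    compatible c K ->
  compatible c (initial_ideal le (ideal_gen (fun p => K p \/ G p))).
Proof.
move=> le_ord Kmon GV cV [K1 K0]; split=> [j j1|].
  apply: (saturated_initial_ideal le_ord Kmon GV) (K1 j j1) => // u v uv.
  by rewrite uv.
apply: (saturated_initial_ideal le_ord Kmon GV) K0 => // u v uv h j j1.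
by rewrite -uv ?h.
Qed.

Lemma compatible_regular t (c : 'I_t.+1 -> 'I_n) K :
    injective c -> is_monomial_ideal K -> compatible c K ->
  regular_mod K (\sum_j 'X_(c j)).
Proof.
move=> c_inj Kmon [K1 K0] g Kfg; apply/(monomial_idealP _ Kmon).
(* The choice of a monomial of maximal degree in [c j] is made by climbing: as long as
   multiplication by [c j] does not lead into [K], a monomial of larger degree in [c j] is found.
   Degrees are bounded by [msize g]. *)
have step j u : u \in msupp g -> ~ K 'X_[u] ->
    exists v, [/\ v \in msupp g, ~ K 'X_[v], (u (c j) <= v (c j))%N
                & K 'X_[(v + U_(c j))%MM]].
  have [d] := ubnP (msize g - u (c j)); elim: d u => // d IHd u du ug nKu.
  case: (classic (K 'X_[(u + U_(c j))%MM])) => [Ku|nKcu]; first by exists u.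
  have : (u + U_(c j))%MM \notin msupp ((\sum_j 'X_(c j)) * g).
    by apply/negP => /((monomial_idealP _ Kmon).1 Kfg).
  rewrite -mcoeff_eq0 mulr_suml raddf_sum /= (bigD1 j) //= addmC [_ * g]mulrC mcoeffMX.
  (* The coefficient of [c j * u] in the product vanishes, so the term from [u] must cancel against
     some [c i * v] with [i != j]. Then [v] has one more factor [c j] than [u], and [v] is outside
     [K] because its multiple [c j * u] is. *)
  rewrite addr_eq0; case: (boolP [exists i, (i != j) && (('X_(c i) * g)@_(U_(c j) + u) != 0)]).
    case/existsP => i /andP[neq]; rewrite -mcoeff_msupp mulrC (perm_mem (msuppMX _ _)).
    case/mapP => v vg uv _.
    have vc : v (c j) = (u (c j)).+1.
      move/mnmP/(_ (c j)): uv; rewrite !mnmDE !mnm1E eqxx add1n.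
      by rewrite (inj_eq c_inj) (negbTE neq) add0n.
    have nKv : ~ K 'X_[v].
      by move=> Kv; apply: nKcu; rewrite addmC uv addmC; apply: monomial_idealMl.
    have uc : (u (c j) < msize g)%N.
      apply: leq_ltn_trans (msize_mdeg_lt ug).
      by rewrite mdegE (bigD1 (c j)) //= leq_addr.
    have [|v' [v'g nKv' le_v Kv']] := IHd v _ vg nKv.
      rewrite vc; apply: leq_trans (_ : (msize g - u (c j)) <= d)%N; last exact: du.
      by rewrite ltn_sub2l.
    by exists v'; split=> //; apply: leq_trans le_v; rewrite vc.
  rewrite negb_exists => /forallP none; rewrite big1 ?oppr0 => [|i neq]; last first.
    by apply/eqP; have := none i; rewrite neq negbK.
  by rewrite mcoeff_eq0 ug.
move=> u ug; apply: NNPP => nKu.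
(* If [c j] divided [v], it would divide the monomial [v'] reached by climbing, and the first
   saturation condition would put [v'] in [K]. Hence the second condition applies to every monomial
   of [g] outside [K]. *)
have supp0 v : v \in msupp g -> ~ K 'X_[v] -> forall j : 'I_t.+1, (1 <= j)%N -> v (c j) = 0%N.
  move=> vg nKv j j1; apply/eqP; rewrite -leqn0 leqNgt; apply/negP => vc.
  have [v' [v'g nKv' le_v /(K1 j j1)]] := step j v vg nKv.
  by move=> /(_ (leq_trans vc le_v)).
have [v [vg nKv _ /K0]] := step ord0 u ug nKu.
by move=> /(_ (supp0 v vg nKv)).
Qed.

End Saturation.


(** * Compatibility along the chain of initial ideals *)

Theorem proposition4p1 (k : fieldType) (n : nat) (I : {mpoly k[n]} -> Prop)
    (hI : is_monomial_ideal I)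
    (q : nat) (t : 'I_q -> nat) (b : forall i : 'I_q, 'I_(t i).+1 -> 'I_n)
    (hb : injective (fun u : {i : 'I_q & 'I_(t i).+1} => b (tag u) (tagged u)))
    (h1 : forall (i : 'I_q) (j : 'I_(t i).+1), (1 <= j)%N ->
       exists2 d, max_exponent (b i j) I d & (d <= 1)%N)
    (h2 : forall (i : 'I_q) (M : 'X_{1..n}), minimal_generator I M ->
       (U_(b i ord0) <= M)%MM ->
       exists2 j : 'I_(t i).+1, (1 <= j)%N & (U_(b i j) <= M)%MM)
    (Y : {set 'I_n}) (hY : forall (i : 'I_q) (j : 'I_(t i).+1), b i j \notin Y)
    (l : nat) (h : 'I_l -> {mpoly k[n]}) (hh : forall s : 'I_l, in_subring Y (h s))
    (hproper : proper_ideal_pred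
       (ideal_gen (fun p => I p \/ exists s : 'I_l, p = h s)))
    (ord : 'I_q -> rel 'X_{1..n}) (hord : forall i : 'I_q, is_term_order (ord i))
    (hlt : forall i i' : 'I_q, i' = i.+1 :> nat ->
       forall j : 'I_(t i).+1, (1 <= j)%N ->
       term_lt (ord i') U_(b i j)%MM U_(b i ord0)%MM) :
  initially_regular ord (ideal_gen (fun p => I p \/ exists s : 'I_l, p = h s))
    (fun i : 'I_q => \sum_(j < (t i).+1) 'X_(b i j)).
Proof.
have b_inj i : injective (b i).
  move=> j j' e; have /eqP := hb (existT _ i j) (existT _ i j') e.
  by rewrite -tag_eqE /tag_eq /= eqxx tagged_asE => /eqP.
have b_neq i i' j j' : i != i' -> b i j != b i' j'.
  move=> neq; apply: contra_neq neq => e.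
  by have /(congr1 (@tag _ _)) := hb (existT _ i j) (existT _ i' j') e.
have compatI i : compatible (b i) I.
  have le_I (u m : 'X_{1..n}) : I 'X_[u] -> (u <= m)%MM -> I 'X_[m].
    by move=> Iu um; rewrite -(submK um) addmC; apply: monomial_idealMl.
  (* In both cases a minimal generator [M] dividing [m] times the variable already divides [m]; only
     the exponent of that variable has to be compared. *)
  split=> [j j1|] m mb /exists_minimal_generator[M Mmin Mm];
    apply: (le_I M _ Mmin.1); apply/mnm_lepP => x;
    have := mnm_lepP Mm x; rewrite mnmDE mnm1E; case: eqP => [<- _|_]; rewrite ?addn0 //.
    have [d [Md _] d1] := h1 i j j1.
    by apply: leq_trans mb; apply: leq_trans d1; apply: Md.
  (* Otherwise [b i ord0] divides [M], so by [h2] some [b i j] with [j >= 1] divides [M], hence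
     [m * b i ord0], although [m] is free of it. *)
  rewrite leqNgt; apply/negP => Mb.
  have [|j j1 /mnm_lepP/(_ (b i j))] := h2 i M Mmin.
    apply/mnm_lepP => y; rewrite mnm1E; case: eqP => // <-.
    exact: leq_ltn_trans Mb.
  rewrite mnm1E eqxx => Mj; have := leq_trans Mj (mnm_lepP Mm (b i j)).
  rewrite mnmDE mnm1E mb // (inj_eq (@b_inj i)).
  by case: eqP j1 => // <-.
(* Compatibility is claimed only for the blocks [i >= r], whose sums have not yet been adjoined at
   stage [r]. *)
have chain_ok (r : nat) (rq : (r < q)%N) :
    let K := initial_chain ord (ideal_gen (fun p => I p \/ exists s : 'I_l, p = h s))
      (fun i : 'I_q => \sum_(j < (t i).+1) 'X_(b i j)) rq in
    is_monomial_ideal K /\ forall i : 'I_q, (r <= i)%N -> compatible (b i) K.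
  elim: r rq => [|r IHr] rq /=; (split; first exact: initial_ideal_monomial) => i ri.
    apply: (compatible_initial_ideal (V := Y)) => // g [s ->]; exact: hh.
  have [Kmon Kcomp] := IHr (ltnW rq); set K := initial_chain _ _ _ _ in Kmon Kcomp *.
  pose r' := Ordinal (ltnW rq).
  (* The adjoined sum involves only the variables of block [r], which are disjoint from those of
     each block [i > r]. *)
  apply: (compatible_initial_ideal (V := [set b r' j | j : 'I_(t r').+1])) => //.
  - move=> g -> m; rewrite mcoeff_msupp => mg x mx.
    have [j mj] : exists j, m = U_(b r' j)%MM.
      apply: NNPP => no; move/eqP: mg; apply; rewrite raddf_sum big1 // => j _ /=.
      by rewrite mcoeffX; case: eqP => // e; case: no; exists j.
    by move: mx; rewrite mj mnm1E; case: eqP => // <- _; apply: imset_f.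
  - move=> j; apply/imsetP => -[j' _ e]; move/eqP: e; apply/negP/b_neq.
    by apply/eqP => e; rewrite e ltnn in ri.
  - by apply: Kcomp; apply: ltnW.
move=> i; have [Kmon Kcomp] := chain_ok i (ltn_ord i); split.
(* The coefficient of [b i ord0] is 1 in the sum, by distinctness of the variables, and 0 in a
   constant. *)
- move=> c; apply/eqP => /(congr1 (mcoeff U_(b i ord0))).
  rewrite mcoeffC mnm1_eq0 mulr0 raddf_sum (bigD1 ord0) //= mcoeffXU eqxx.
  rewrite big1 => [|j j0]; first by rewrite addr0; apply/eqP/oner_neq0.
  by rewrite mcoeffXU (inj_eq (@b_inj i)) (negbTE j0).
- elim/big_rec: _ => [|j p _ irr]; first exact: ideal_gen0.
  by apply: ideal_genD irr; apply: ideal_gen_incl; exists (b i j).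
- by apply: compatible_regular => //; apply: Kcomp.
Qed.
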